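(* For any paired symmetric (elasticity) tensor $\mathscr{A}\in\mathbb{T}_{4,3}$, the biquadratic form $\mathscr{A}x^2y^2$ is a sum of squares of bilinear forms if and only if an unfolded matrix of some semi-paired symmetric tensor of $\mathscr{A}$ is positive semidefinite.
   Context: $\mathbb{T}_{4,3}$ is the set of real tensors $\mathscr{A}=(a_{ijkl})$ with $i,j,k,l\in\{1,2,3\}$. $\mathscr{A}$ is paired symmetric if $a_{ijkl}=a_{jikl}=a_{ijlk}=a_{jilk}$ for all indices; it is an elasticity tensor if moreover $a_{ijkl}=a_{klij}$ for all indices. ''Paired symmetric (elasticity) tensor'' means that the statement is made for paired symmetric tensors and likewise for elasticity tensors. For $x,y\in\mathbb{R}^3$, $\mathscr{A}x^2y^2:=\sum_{i,j,k,l=1}^3a_{ijkl}x_ix_jy_ky_l$; it is a sum of squares of bilinear forms if it equals $\sum_{s=1}^r\big(\sum_{i,j=1}^3\alpha^s_{ij}x_iy_j\big)^2$ identically for some $r\ge1$ and real $\alpha^s_{ij}$. A tensor $\mathscr{B}=(b_{ijkl})\in\mathbb{T}_{4,3}$ is a semi-paired symmetric tensor of the paired symmetric tensor $\mathscr{A}$ if for all indices $b_{ijkl}=b_{jilk}$, $b_{ijlk}=b_{jikl}$ and $b_{ijkl}+b_{jilk}+b_{ijlk}+b_{jikl}=4a_{ijkl}$. An unfolded matrix of $\mathscr{B}$ is a $9\times9$ matrix with $(s,t)$ entry $b_{i_si_tj_sj_t}$ for $s,t\in\{1,\ldots,9\}$, where $i_1i_2\cdots i_9$ and $j_1j_2\cdots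 j_9$ are two arbitrary permutations of $123123123$ (sequences of length 9 in which each of $1,2,3$ occurs three times).
   Formalization: In an unfolded matrix the nine pairs (i_s, j_s) are required to be pairwise distinct; with two arbitrary permutations of 123123123 the claim fails, e.g. both equal to 123123123, a_1122 = a_2211 = -1 and all other entries 0, where the unfolded matrix is 0. *)

(* Defs.v *)
From mathcomp Require Import all_boot all_order all_algebra.
From mathcomp Require Import reals.

Set Implicit Arguments.
Unset Strict Implicit.
Unset Printing Implicit Defensive.

Import Order.TTheory GRing.Theory Num.Theory.
Local Open Scope ring_scope.

Definition tensor43 (R : realType) : Type := 'I_3 -> 'I_3 -> 'I_3 -> 'I_3 -> R.

Definition paired_symmetric (R : realType) (A : tensor43 R) : Prop :=
  forall i j k l : 'I_3,
    [/\ A i j k l = A j i k l, A i j k l = A i j l k & A i j k l = A j i l k].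

Definition elasticity (R : realType) (A : tensor43 R) : Prop :=
  paired_symmetric A /\ forall i j k l : 'I_3, A i j k l = A k l i j.

Definition biquadratic (R : realType) (A : tensor43 R) (x y : 'cV[R]_3) : R :=
  \sum_(i < 3) \sum_(j < 3) \sum_(k < 3) \sum_(l < 3)
    A i j k l * x i 0 * x j 0 * y k 0 * y l 0.

Definition sos_bilinear (R : realType) (f : 'cV[R]_3 -> 'cV[R]_3 -> R) : Prop :=
  exists r : nat, (0 < r)%N /\
    exists alpha : 'I_r -> 'M[R]_3, forall x y : 'cV[R]_3,
      f x y =
      \sum_(s < r)
        (\sum_(i < 3) \sum_(j < 3) alpha s i j * x i 0 * y j 0) ^+ 2.

Definition semi_paired_symmetric (R : realType) (A B : tensor43 R) : Prop :=
  forall i j k l : 'I_3,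
    [/\ B i j k l = B j i l k,
        B i j l k = B j i k l &
        B i j k l + B j i l k + B i j l k + B j i k l = 4%:R * A i j k l].

(* The sequence 123123123, with the indices 1, 2, 3 coded as 0, 1, 2 : 'I_3. *)
Definition word123 : seq 'I_3 := flatten (nseq 3 (enum 'I_3)).

(* u and v are the sequences i_1 .. i_9 and j_1 .. j_9. The pairs (u_s, v_s)
   must be pairwise distinct, i.e. enumerate all nine index pairs, so that each
   of the 81 entries of B occurs exactly once in M. Without this, u = v would be
   allowed; M would then only see the entries b_ijij and could vanish while
   A x^2 y^2 = - x_1^2 y_2^2. *)
Definition unfolded_matrix (R : realType) (B : tensor43 R) (M : 'M[R]_9) : Prop :=
  exists u v : 9.-tuple 'I_3,
    [/\ perm_eq u word123, perm_eq v word123, uniq (zip u v) &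
        M = \matrix_(s < 9, t < 9)
              B (tnth u s) (tnth u t) (tnth v s) (tnth v t)].

Definition positive_semidefinite (R : realType) (n : nat) (M : 'M[R]_n) : Prop :=
  M^T = M /\ forall z : 'cV[R]_n, 0 <= (z^T *m M *m z) 0 0.

(* Main.v *)
(** If [z] lists the nine products [x_i y_k], then the quadratic form of an
    unfolded matrix of [B] at [z] is the biquadratic form of [B], and this is
    the one of [A], since pairing only averages coefficients of equal
    monomials. A positive semidefinite unfolded matrix is a Gram matrix, and
    each of its rows is a bilinear form in [x] and [y]. Conversely, bilinear
    forms [alpha^s] give the Gram tensor
    [b_ijkl = sum_s alpha^s_ik alpha^s_jl]; its paired symmetrization is [A]
    because the coefficients of a biquadratic form are determined, by
    polarization in [x] and then in [y], once paired symmetry is imposed. *)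
Require Import Defs.
From mathcomp Require Import all_boot all_order all_algebra.
From mathcomp Require Import reals ring lra.

Set Implicit Arguments.
Unset Strict Implicit.
Unset Printing Implicit Defensive.

Import Order.TTheory GRing.Theory Num.Theory.
Local Open Scope ring_scope.

(** * Positive semidefinite matrices as Gram matrices *)

Lemma gram_psd (R : realType) (m n : nat) (L : 'M[R]_(m, n)) :
  positive_semidefinite (L^T *m L).
Proof.
split; first by rewrite trmx_mul trmxK.
move=> z; rewrite mulmxA -trmx_mul -mulmxA mxE.
by apply: sumr_ge0 => i _; rewrite mxE -expr2 sqr_ge0.
Qed.

(** This is the form at the column with head [t] and tail [w]; [t] stays free so that it can be
    chosen in terms of [w]. *)
Lemma psd_block_ge0 (R : realType) (n : nat) (a : R) (b : 'rV[R]_n)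
    (C : 'M[R]_n) (t : R) (w : 'cV[R]_n) :
  positive_semidefinite (block_mx a%:M b b^T C) ->
  0 <= a * t ^+ 2 + 2%:R * t * (b *m w) 0 0 + (w^T *m C *m w) 0 0.
Proof.
move=> [_ /(_ (col_mx t%:M w))]; congr (0 <= _).
rewrite tr_col_mx mul_row_block mul_row_col !mulmxDl tr_scalar_mx.
rewrite !mul_mx_scalar !mul_scalar_mx -scalemxAl -trmx_mul.
rewrite !mxE /= mulr1n; ring.
Qed.

(** With a zero corner the form is affine in [t], so its slope must vanish; at [w = b^T] the slope
    is twice the squared norm of [b]. *)
Lemma psd_block0 (R : realType) (n : nat) (b : 'rV[R]_n) (C : 'M[R]_n) :
  positive_semidefinite (block_mx (0 : R)%:M b b^T C) -> b = 0.
Proof.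
move=> psd0.
have P t (w : 'cV_n) : 0 <= 2%:R * t * (b *m w) 0 0 + (w^T *m C *m w) 0 0.
  by have := psd_block_ge0 t w psd0; rewrite mul0r add0r.
have bb0 : (b *m b^T) 0 0 = 0.
  apply/eqP/negP => /negP nz.
  (* This [t] gives the affine function the value -1. *)
  have := P (- ((b^T^T *m C *m b^T) 0 0 + 1) / (2%:R * (b *m b^T) 0 0)) b^T.
  set q := (b^T^T *m _ *m _) 0 0; set p := (b *m b^T) 0 0 in nz *.
  have -> : 2%:R * (- (q + 1) / (2%:R * p)) * p + q = -1 by field.
  by rewrite oppr_ge0 ler10.
apply/rowP => j; move: bb0; rewrite mxE.
under eq_bigr => i _ do rewrite mxE -expr2.
move/eqP; rewrite psumr_eq0; last by move=> i _; rewrite sqr_ge0.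
by move/allP/(_ j (mem_index_enum j)); rewrite sqrf_eq0 mxE => /eqP.
Qed.

(** Cholesky factorization by induction on the size: a zero pivot [a] forces [b = 0], and a positive
    one leaves a positive semidefinite Schur complement. *)
Lemma psd_gram (R : realType) (n : nat) (M : 'M[R]_n) :
  positive_semidefinite M -> exists L : 'M[R]_n, M = L^T *m L.
Proof.
elim: n M => [|n IHn] M psdM; first by exists 0; apply/matrixP => -[].
have [a [b [C eM]]] : exists (a : R) (b : 'rV_n) (C : 'M_n),
    M = block_mx a%:M b b^T C.
  exists (@ulsubmx R 1 n 1 n M 0 0), (@ursubmx R 1 n 1 n M),
    (@drsubmx R 1 n 1 n M).
  rewrite trmx_ursub psdM.1 -mx11_scalar; exact/esym/(@submxK R 1 n 1 n M).
have CT : C^T = C.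
  have := psdM.1; rewrite eM (@tr_block_mx R 1 n 1 n).
  by move/(@eq_block_mx R 1 n 1 n) => [].
rewrite {}eM in psdM *.
have a0 : 0 <= a.
  have := psd_block_ge0 1 0 psdM; rewrite !mulmx0 !mxE.
  by rewrite expr1n mulr1 mulr0 !addr0.
have [a_eq0|a_neq0] := eqVneq a 0.
  rewrite a_eq0 in psdM *.
  have b0 := psd_block0 psdM; rewrite {}b0 in psdM *.
  have [|L eC] := IHn C.
    split=> // w; have := psd_block_ge0 0 w psdM.
    by rewrite mul0r mulr0 mul0r !add0r.
  exists (block_mx (0 : 'M_1) 0 0 L).
  rewrite (@tr_block_mx R 1 n 1 n) (@mulmx_block R 1 n 1 n 1 n) !trmx0.
  by rewrite !mul0mx !mulmx0 !addr0 add0r -eC raddf0.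
have [|L eC] := IHn (C - a^-1 *: (b^T *m b)).
  split; first by rewrite linearB linearZ /= trmx_mul trmxK CT.
  (* For fixed [w] this [t] minimizes the form, and the minimum is the form of the Schur complement
     at [w]. *)
  move=> w; have := psd_block_ge0 (- (b *m w) 0 0 / a) w psdM.
  have bbE : (w^T *m (b^T *m b) *m w) 0 0 = (b *m w) 0 0 ^+ 2.
    by rewrite mulmxA -trmx_mul -mulmxA mxE big_ord1 mxE.
  rewrite mulmxBr mulmxBl -scalemxAr -scalemxAl.
  rewrite [X in _ -> 0 <= X]mxE [X in _ -> 0 <= _ + X]mxE.
  rewrite [X in _ -> 0 <= _ - X]mxE bbE.
  set p := (b *m w) 0 0; set q := (w^T *m C *m w) 0 0.
  by congr (0 <= _); field.
have sa : Num.sqrt a != 0 by rewrite sqrtr_eq0 -ltNge lt_def a_neq0.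
(* The first row contributes [a^-1 *: (b^T *m b)] to the lower right block, which restores what the
   Schur complement subtracts. *)
exists (block_mx (Num.sqrt a)%:M ((Num.sqrt a)^-1 *: b) 0 L).
rewrite (@tr_block_mx R 1 n 1 n) (@mulmx_block R 1 n 1 n 1 n) !trmx0 -eC.
rewrite !mul0mx mulmx0 !addr0 tr_scalar_mx -scalar_mxM -expr2 sqr_sqrtr //.
have -> : ((Num.sqrt a)^-1 *: b)^T = (Num.sqrt a)^-1 *: b^T by rewrite linearZ.
rewrite mul_scalar_mx mul_mx_scalar !scalerA divff // !scale1r.
rewrite -scalemxAl -scalemxAr scalerA -invfM -expr2 sqr_sqrtr //.
by rewrite addrC subrK.
Qed.

(** * Paired symmetric tensors and their biquadratic forms *)

Lemma sum_unit (R : realType) (n : nat) (F : 'I_n -> R) (i : 'I_n) :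
  \sum_(k < n) F k * (k == i)%:R = F i.
Proof.
rewrite (bigD1 i) //= eqxx mulr1 big1 ?addr0 // => k /negPf ->.
by rewrite mulr0.
Qed.

Lemma symmetric_form_eq0 (R : realType) (n : nat) (f : 'I_n -> 'I_n -> R) :
  (forall i j, f i j = f j i) ->
  (forall x : 'cV[R]_n, \sum_(i < n) \sum_(j < n) f i j * x i 0 * x j 0 = 0) ->
  forall i j, f i j = 0.
Proof.
move=> fC f0 i j.
(* Evaluation at the sum of the unit vectors of [k] and [l]; the case [k = l] gives the diagonal
   coefficients. *)
have F (k l : 'I_n) : f k k + f k l + (f l k + f l l) = 0.
  have := f0 (\col_m ((m == k)%:R + (m == l)%:R)).
  under eq_bigr => p _.
    under eq_bigr => q _ do rewrite !mxE mulrDr.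
    rewrite big_split /= !sum_unit -mulrDl mulrDr.
    over.
  rewrite big_split /= !sum_unit => <-; ring.
have := F i i; have := F j j; have := F i j; rewrite (fC j i) => ? ? ?; lra.
Qed.

Lemma eq_sum4 (R : realType) (F G : 'I_3 -> 'I_3 -> 'I_3 -> 'I_3 -> R) :
  (forall i j k l, F i j k l = G i j k l) ->
  \sum_(i < 3) \sum_(j < 3) \sum_(k < 3) \sum_(l < 3) F i j k l =
  \sum_(i < 3) \sum_(j < 3) \sum_(k < 3) \sum_(l < 3) G i j k l.
Proof. by move=> FG; do 4![apply: eq_bigr => ? _]. Qed.

Lemma biquadratic_nested (R : realType) (A : tensor43 R) (x y : 'cV[R]_3) :
  biquadratic A x y = \sum_(i < 3) \sum_(j < 3)
    (\sum_(k < 3) \sum_(l < 3) A i j k l * y k 0 * y l 0) * x i 0 * x j 0.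
Proof.
apply: eq_bigr => i _; apply: eq_bigr => j _; rewrite !mulr_suml.
apply: eq_bigr => k _; rewrite !mulr_suml; apply: eq_bigr => l _; ring.
Qed.

(** For fixed [i] and [j], polarization in [y] isolates [A i j k l]; the form in [y] vanishes by
    polarization in [x] at each fixed [y]. *)
Lemma paired_symmetric_eq0 (R : realType) (A : tensor43 R) :
  paired_symmetric A -> (forall x y, biquadratic A x y = 0) ->
  forall i j k l, A i j k l = 0.
Proof.
move=> sA A0 i j.
apply: symmetric_form_eq0 => [k l|y]; first by case: (sA i j k l).
apply: (@symmetric_form_eq0 R 3
  (fun i j => \sum_(k < 3) \sum_(l < 3) A i j k l * y k 0 * y l 0)) => [p q|x].
  apply: eq_bigr => k _; apply: eq_bigr => l _.
  by case: (sA p q k l) => ->.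
by rewrite -biquadratic_nested.
Qed.

(** Four times the paired symmetrization, undivided to match the factor 4 in
    [semi_paired_symmetric]. *)
Definition paired_sum (R : realType) (B : tensor43 R) : tensor43 R :=
  fun i j k l => B i j k l + B j i l k + B i j l k + B j i k l.

Lemma biquadratic_comb (R : realType) (a b : R) (A B : tensor43 R) x y :
  biquadratic (fun i j k l => a * A i j k l + b * B i j k l) x y =
  a * biquadratic A x y + b * biquadratic B x y.
Proof.
rewrite /biquadratic !mulr_sumr -big_split; apply: eq_bigr => i _ /=.
rewrite !mulr_sumr -big_split; apply: eq_bigr => j _ /=.
rewrite !mulr_sumr -big_split; apply: eq_bigr => k _ /=.
rewrite !mulr_sumr -big_split; apply: eq_bigr => l _ /=.
ring.
Qed.

Lemma biquadratic_swapl (R : realType) (B : tensor43 R) x y :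
  biquadratic (fun i j k l => B j i k l) x y = biquadratic B x y.
Proof.
rewrite /biquadratic exchange_big; apply: eq_sum4 => i j k l /=; ring.
Qed.

Lemma biquadratic_swapr (R : realType) (B : tensor43 R) x y :
  biquadratic (fun i j k l => B i j l k) x y = biquadratic B x y.
Proof.
apply: eq_bigr => i _; apply: eq_bigr => j _; rewrite exchange_big.
apply: eq_bigr => k _; apply: eq_bigr => l _ /=; ring.
Qed.

Lemma biquadratic_paired_sum (R : realType) (B : tensor43 R) x y :
  biquadratic (paired_sum B) x y = 4%:R * biquadratic B x y.
Proof.
(* The unit coefficients fit [biquadratic_comb], which read from right to left merges the four forms
   into one. *)
have -> : 4%:R * biquadratic B x y =
    1 * (1 * biquadratic B x y
         + 1 * biquadratic (fun i j k l => B j i l k) x y)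
    + 1 * (1 * biquadratic (fun i j k l => B i j l k) x y
           + 1 * biquadratic (fun i j k l => B j i k l) x y).
  rewrite (biquadratic_swapl (fun i j k l => B i j l k) x y).
  rewrite (biquadratic_swapl B) (biquadratic_swapr B); ring.
rewrite -!biquadratic_comb; apply: eq_sum4 => i j k l.
by rewrite /paired_sum !mul1r !addrA.
Qed.

Lemma semi_paired_biquadratic (R : realType) (A B : tensor43 R) x y :
  semi_paired_symmetric A B -> biquadratic B x y = biquadratic A x y.
Proof.
move=> AB; have n4 : (4%:R : R) != 0 by rewrite pnatr_eq0.
apply: (mulfI n4); rewrite -biquadratic_paired_sum.
(* The added zero multiple lets [biquadratic_comb] absorb the factor 4 into the tensor. *)
rewrite -[RHS]addr0 -[X in _ + X](mul0r (biquadratic A x y)) -biquadratic_comb.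
apply: eq_sum4 => i j k l; rewrite mul0r addr0.
by case: (AB i j k l) => _ _ <-.
Qed.

(** The difference [D] between the paired sum of [B] and four times [A] is paired symmetric with
    zero biquadratic form, hence zero. *)
Lemma semi_paired_of_biquadratic (R : realType) (A B : tensor43 R) :
  paired_symmetric A -> (forall i j k l, B i j k l = B j i l k) ->
  (forall x y, biquadratic B x y = biquadratic A x y) ->
  semi_paired_symmetric A B.
Proof.
move=> sA sB AB i j k l; split=> //.
pose D : tensor43 R :=
  fun i j k l => 1 * paired_sum B i j k l + - 4%:R * A i j k l.
suff /(_ i j k l) : forall i j k l, D i j k l = 0.
  by rewrite /D mul1r mulNr => /eqP; rewrite subr_eq0 => /eqP.
apply: paired_symmetric_eq0 => [p q r s|x y].
  rewrite /D /paired_sum; case: (sA p q r s) => <- <- <-.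
  by split; congr (_ * _ + _); ring.
by rewrite biquadratic_comb biquadratic_paired_sum AB mul1r mulNr subrr.
Qed.

(** * Index pairs enumerated by an unfolding *)

Lemma zip_bijective (u v : 9.-tuple 'I_3) :
  uniq (zip u v) -> bijective (fun s => (tnth u s, tnth v s)).
Proof.
(* There are nine index pairs, so injectivity suffices. *)
move=> uv; apply: inj_card_bij; last by rewrite card_prod !card_ord.
move=> s t; rewrite !(tnth_nth ord0) -!nth_zip ?size_tuple // => /eqP.
by rewrite nth_uniq ?size_zip ?size_tuple ?ltn_ord // => /eqP/val_inj.
Qed.

Lemma sum_unfold (R : realType) (u v : 9.-tuple 'I_3) (F : 'I_3 -> 'I_3 -> R) :
  uniq (zip u v) ->
  \sum_(s < 9) F (tnth u s) (tnth v s) = \sum_(i < 3) \sum_(k < 3) F i k.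
Proof.
move=> /zip_bijective bij; rewrite pair_big /=.
by rewrite (reindex _ (onW_bij _ bij)).
Qed.

(** The row index [s] encodes the pair [(i, k)] and the column index [t] the pair [(j, l)]; both run
    through all nine pairs. *)
Lemma quad_unfolded (R : realType) (B : tensor43 R) (u v : 9.-tuple 'I_3)
    (x y : 'cV[R]_3) (z := \col_s (x (tnth u s) 0 * y (tnth v s) 0)) :
  uniq (zip u v) ->
  (z^T *m (\matrix_(s, t) B (tnth u s) (tnth u t) (tnth v s) (tnth v t)) *m z)
    0 0 = biquadratic B x y.
Proof.
move=> uv; rewrite mxE.
under eq_bigr => t _.
  rewrite mxE [z t 0]mxE.
  under eq_bigr => s _ do rewrite !mxE.
  rewrite (sum_unfold (fun i k => x i 0 * y k 0 * B i (tnth u t) k (tnth v t)))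
    //.
  over.
rewrite (sum_unfold (fun j l =>
  (\sum_(i < 3) \sum_(k < 3) x i 0 * y k 0 * B i j k l) * (x j 0 * y l 0))) //.
rewrite /biquadratic [RHS]exchange_big; apply: eq_bigr => j _ /=.
under [RHS]eq_bigr => i _ do rewrite exchange_big /=.
rewrite [RHS]exchange_big; apply: eq_bigr => l _ /=.
rewrite mulr_suml; apply: eq_bigr => i _; rewrite mulr_suml.
apply: eq_bigr => k _; ring.
Qed.

Lemma exists_unfolding : exists u v : 9.-tuple 'I_3,
  [/\ perm_eq u word123, perm_eq v word123 & uniq (zip u v)].
Proof.
(* The words 000111222 and 012012012 together list every index pair once. *)
have su : size (flatten [seq nseq 3 i | i <- enum 'I_3]) == 9.
  by rewrite !enum_ordSl enum_ord0.
have sv : size word123 == 9 by rewrite /word123 !enum_ordSl enum_ord0.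
exists (Tuple su), (Tuple sv).
by split; rewrite /= /word123 !enum_ordSl enum_ord0.
Qed.

(** * The two implications *)

Lemma sos_psd (R : realType) (A : tensor43 R) :
  paired_symmetric A -> sos_bilinear (biquadratic A) ->
  exists (B : tensor43 R) (M : 'M[R]_9),
    [/\ semi_paired_symmetric A B, unfolded_matrix B M &
        positive_semidefinite M].
Proof.
move=> sA [r [_ [alpha sos]]].
pose B : tensor43 R := fun i j k l => \sum_(s < r) alpha s i k * alpha s j l.
have [u [v [pu pv uv]]] := exists_unfolding.
(* Row [s] lists the coefficients of the form [alpha s] in the order of the unfolding, so [L^T *m L]
   unfolds [B]. *)
pose L : 'M[R]_(r, 9) := \matrix_(s, t) alpha s (tnth u t) (tnth v t).
exists B, (L^T *m L); split; last exact: gram_psd.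
- apply: semi_paired_of_biquadratic => // [i j k l|x y].
    by apply: eq_bigr => s _; rewrite mulrC.
  rewrite sos /biquadratic.
  (* In each square the first factor is indexed by [(i, k)] and the second by [(j, l)], nested as
     [i], [j], [k], [l]; the sum over [s] then moves innermost. *)
  under [RHS]eq_bigr => s _.
    rewrite expr2 mulr_suml.
    under eq_bigr => i _.
      rewrite mulr_sumr.
      under eq_bigr => j _.
        rewrite mulr_suml.
        under eq_bigr => k _ do rewrite mulr_sumr.
        over.
      over.
    over.
  rewrite [RHS]exchange_big /=; apply: eq_bigr => i _.
  rewrite [RHS]exchange_big /=; apply: eq_bigr => j _.
  rewrite [RHS]exchange_big /=; apply: eq_bigr => k _.
  rewrite [RHS]exchange_big /=; apply: eq_bigr => l _.
  rewrite /B !mulr_suml; apply: eq_bigr => s _; ring.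
- exists u, v; split=> //; apply/matrixP => s t; rewrite !mxE.
  by apply: eq_bigr => q _; rewrite !mxE.
Qed.

Lemma psd_sos (R : realType) (A B : tensor43 R) (M : 'M[R]_9) :
  semi_paired_symmetric A B -> unfolded_matrix B M ->
  positive_semidefinite M -> sos_bilinear (biquadratic A).
Proof.
move=> AB [u [v [_ _ uv eM]]] /psd_gram[L eL].
have [h hK _] := zip_bijective uv.
(* Each row of [L] is one bilinear form; [h] sends an index pair to its position in the
   unfolding. *)
exists 9; split=> //; exists (fun s => \matrix_(i, j) L s (h (i, j))) => x y.
rewrite -(semi_paired_biquadratic x y AB) -(quad_unfolded B x y uv) -eM eL.
set z := \col_s _; rewrite mulmxA -trmx_mul -mulmxA mxE.
apply: eq_bigr => s _; rewrite mxE -expr2; congr (_ ^+ 2).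
under [RHS]eq_bigr => i _ do under eq_bigr => j _ do rewrite mxE.
rewrite -(sum_unfold (fun i j => L s (h (i, j)) * x i 0 * y j 0) uv) mxE.
by apply: eq_bigr => t _; rewrite hK mxE mulrA.
Qed.

Theorem theorem5p9 (R : realType) (A : tensor43 R) :
  (paired_symmetric A ->
     (sos_bilinear (biquadratic A) <->
      exists (B : tensor43 R) (M : 'M[R]_9),
        [/\ semi_paired_symmetric A B, unfolded_matrix B M &
            positive_semidefinite M]))
  /\
  (elasticity A ->
     (sos_bilinear (biquadratic A) <->
      exists (B : tensor43 R) (M : 'M[R]_9),
        [/\ semi_paired_symmetric A B, unfolded_matrix B M &
            positive_semidefinite M])).
Proof.
(* Elasticity includes paired symmetry, so the first equivalence yields the second. *)
suff H : paired_symmetric A ->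
    (sos_bilinear (biquadratic A) <->
     exists (B : tensor43 R) (M : 'M[R]_9),
       [/\ semi_paired_symmetric A B, unfolded_matrix B M &
           positive_semidefinite M]) by split=> // -[/H].
move=> sA; split=> [/(sos_psd sA) //|[B [M [AB BM psdM]]]].
exact: psd_sos AB BM psdM.
Qed.
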